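(* Let $\mathbb{K}$ be a field of characteristic zero, $\mathcal{K}$ a non-empty set of finite groups, and $\ell : \mathbb{N}-\{0\} \to \mathbb{K}^\times$ a monoid homomorphism. Suppose $\mathcal{K}$ is finite and $\Lambda$ is semisimple. Let $E$ run over representatives of the isomorphism classes of the factor groups of the elements of $\mathcal{K}$. Then there is an isomorphism of algebras over $\mathbb{K}$ $$\Lambda\cong\bigoplus_E \mathrm{Mat}_{n_E}(\mathbb{K}\,\mathrm{Aut}(E))$$ where $n_E$ is the number of triples $(G,B,Y)$ such that $G\in\mathcal{K}$, $G\geq B\unrhd Y$ and $B/Y\cong E$.
   Context: Factor group: a subquotient of a group $R$ is a group $M/N$ with $R\geq M\unrhd N$; a group $S$ is called a factor group of $R$ if $S$ is isomorphic to a subquotient of $R$. $\mathrm{Aut}(E)$ is the automorphism group of $E$, $\mathbb{K}\,\mathrm{Aut}(E)$ its group algebra, and $\mathrm{Mat}_n$ denotes $n\times n$ matrices. Subgroups of direct products: for groups $F,G$, elements of $F\times G$ are written $f\times g$, and $\mathcal{S}(F,G)$ is the set of subgroups of $F\times G$. For $U\in\mathcal{S}(F,G)$, put $U_\bullet=\{g\in G: 1\times g\in U\}$ and ${}_\bullet U=\{f\in F: f\times 1\in U\}$. For $U\in\mathcal{S}(F,G)$, $V\in\mathcal{S}(G,H)$, the star product $U*V\in\mathcal{S}(F,H)$ is the subgroup of those $f\times h$ for which there exists $g\in G$ with $f\times g\in U$ and $g\times h\in V$. Put $\sigma(U,V)=\ell(|U_\bullet\cap{}_\bullet V|)$ (here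 $\ell$ is defined on the multiplicative monoid of positive integers). The algebra $\Lambda=\Lambda_{\mathcal{K}}$ over $\mathbb{K}$ has $\mathbb{K}$-basis consisting of formal symbols $s_U^{F,G}$ with $F,G\in\mathcal{K}$ and $U\in\mathcal{S}(F,G)$, with multiplication $s_U^{F,G}s_V^{G,H}=\sigma(U,V)\,s_{U*V}^{F,H}$, and $s_U^{F,G}s_V^{G',H}=0$ when $G\neq G'$. When $\mathcal{K}$ is finite, $\Lambda$ is unital. *)

(* Defs.v *)
From HB Require Import structures.
From mathcomp Require Import all_boot all_order all_algebra all_fingroup falgebra.

Set Implicit Arguments.
Unset Strict Implicit.
Unset Printing Implicit Defensive.

Import GRing.Theory.
Local Open Scope ring_scope.

Section Semisimple.

Variables (K : fieldType) (A : falgType K).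

Definition left_ideal (L : {vspace A}) : bool := ({:A} * L <= L)%VS.

Definition simple_left_ideal (L : {vspace A}) : Prop :=
  [/\ left_ideal L, L != 0%VS
    & forall M : {vspace A},
        left_ideal M -> (M <= L)%VS -> M = 0%VS \/ M = L].

Definition semisimple : Prop :=
  exists (r : nat) (L : 'I_r -> {vspace A}),
    [/\ forall i, simple_left_ideal (L i),
        directv (\sum_(i < r) L i)
      & (\sum_(i < r) L i)%VS = fullv].

End Semisimple.

(* The direct sum of the K-algebras Mat_(n j)(A j). It is an alias because the
   canonical scalars of 'M[A]_n are those of A instead of K. It has no algType
   structure because that requires 1 != 0, hence some n j to be nonzero. *)
Section MatrixSum.

Variables (K : fieldType) (J : finType) (A : J -> algType K) (n : J -> nat).

Definition mx_sum : Type := {dffun forall j, 'M[A j]_(n j)}.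

HB.instance Definition _ := Choice.on mx_sum.

Implicit Types x y z : mx_sum.

Definition mx_sum_zero : mx_sum := [ffun j => 0 : 'M[A j]_(n j)].
Definition mx_sum_opp x : mx_sum := [ffun j => - x j : 'M[A j]_(n j)].
Definition mx_sum_add x y : mx_sum := [ffun j => x j + y j : 'M[A j]_(n j)].
Definition mx_sum_one : mx_sum := [ffun j => 1%:M : 'M[A j]_(n j)].
Definition mx_sum_mul x y : mx_sum := [ffun j => x j *m y j : 'M[A j]_(n j)].
Definition mx_sum_scale (c : K) x : mx_sum :=
  [ffun j => map_mx (fun a : A j => c *: a) (x j) : 'M[A j]_(n j)].

Fact mx_sum_addA : associative mx_sum_add.
Proof. by move=> x y z; apply/ffunP => j; rewrite !ffunE addrA. Qed.
Fact mx_sum_addC : commutative mx_sum_add.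
Proof. by move=> x y; apply/ffunP => j; rewrite !ffunE addrC. Qed.
Fact mx_sum_add0 : left_id mx_sum_zero mx_sum_add.
Proof. by move=> x; apply/ffunP => j; rewrite !ffunE add0r. Qed.
Fact mx_sum_addN : left_inverse mx_sum_zero mx_sum_opp mx_sum_add.
Proof. by move=> x; apply/ffunP => j; rewrite !ffunE addNr. Qed.

HB.instance Definition _ := GRing.isZmodule.Build mx_sum
  mx_sum_addA mx_sum_addC mx_sum_add0 mx_sum_addN.

Fact mx_sum_mulA : associative mx_sum_mul.
Proof. by move=> x y z; apply/ffunP => j; rewrite !ffunE mulmxA. Qed.
Fact mx_sum_mul1l : left_id mx_sum_one mx_sum_mul.
Proof. by move=> x; apply/ffunP => j; rewrite !ffunE mul1mx. Qed.
Fact mx_sum_mul1r : right_id mx_sum_one mx_sum_mul.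
Proof. by move=> x; apply/ffunP => j; rewrite !ffunE mulmx1. Qed.
Fact mx_sum_mulDl : left_distributive mx_sum_mul +%R.
Proof. by move=> x y z; apply/ffunP => j; rewrite !ffunE mulmxDl. Qed.
Fact mx_sum_mulDr : right_distributive mx_sum_mul +%R.
Proof. by move=> x y z; apply/ffunP => j; rewrite !ffunE mulmxDr. Qed.

HB.instance Definition _ := GRing.Zmodule_isPzRing.Build mx_sum
  mx_sum_mulA mx_sum_mul1l mx_sum_mul1r mx_sum_mulDl mx_sum_mulDr.

Fact mx_sum_scaleA a b x :
  mx_sum_scale a (mx_sum_scale b x) = mx_sum_scale (a * b) x.
Proof.
by apply/ffunP => j; apply/matrixP => k l; rewrite !ffunE !mxE scalerA.
Qed.
Fact mx_sum_scale1 : left_id 1 mx_sum_scale.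
Proof.
by move=> x; apply/ffunP => j; apply/matrixP => k l; rewrite !ffunE !mxE scale1r.
Qed.
Fact mx_sum_scaleDr : right_distributive mx_sum_scale +%R.
Proof.
move=> c x y; apply/ffunP => j; apply/matrixP => k l.
by rewrite !ffunE !mxE scalerDr.
Qed.
Fact mx_sum_scaleDl x : {morph mx_sum_scale^~ x : a b / a + b}.
Proof.
move=> a b; apply/ffunP => j; apply/matrixP => k l.
by rewrite !ffunE !mxE scalerDl.
Qed.

HB.instance Definition _ := GRing.Zmodule_isLmodule.Build K mx_sum
  mx_sum_scaleA mx_sum_scale1 mx_sum_scaleDr mx_sum_scaleDl.

Lemma mx_sum_scalerAl (c : K) x y : c *: (x * y) = (c *: x) * y.
Proof.
apply/ffunP => j; apply/matrixP => k l; rewrite !ffunE !mxE scaler_sumr.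
by apply: eq_bigr => q _; rewrite mxE scalerAl.
Qed.

Lemma mx_sum_scalerAr (c : K) x y : c *: (x * y) = x * (c *: y).
Proof.
apply/ffunP => j; apply/matrixP => k l; rewrite !ffunE !mxE scaler_sumr.
by apply: eq_bigr => q _; rewrite mxE scalerAr.
Qed.

End MatrixSum.

Section GroupAlgebra.

Variables (K : fieldType) (H : finGroupType).

Definition group_alg : Type := {ffun H -> K^o}.

HB.instance Definition _ := Vector.on group_alg.

Implicit Types x y z : group_alg.

Definition galg_one : group_alg := [ffun h => (h == 1%g)%:R].
Definition galg_mul x y : group_alg :=
  [ffun h => \sum_(g : H) x g * y (g^-1 * h)%g].

Fact galg_mulA : associative galg_mul.
Proof.
move=> x y z; apply/ffunP => h; rewrite !ffunE.
transitivity (\sum_(g : H) \sum_(k : H) x g * y (g^-1 * k)%g * z (k^-1 * h)%g).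
  apply: eq_bigr => g _; rewrite ffunE mulr_sumr.
  rewrite (reindex_inj (mulgI g^-1%g)); apply: eq_bigr => k _ /=.
  by rewrite mulrA invMg invgK -!mulgA mulKVg.
rewrite exchange_big; apply: eq_bigr => k _ /=.
by rewrite ffunE mulr_suml.
Qed.
Fact galg_mul1l : left_id galg_one galg_mul.
Proof.
move=> x; apply/ffunP => h; rewrite ffunE (bigD1 1%g) //= big1 => [|g /negPf g1].
  by rewrite ffunE eqxx mul1r invg1 mul1g addr0.
by rewrite ffunE g1 mul0r.
Qed.
Fact galg_mul1r : right_id galg_one galg_mul.
Proof.
move=> x; apply/ffunP => h; rewrite ffunE (bigD1 h) //= big1 => [|g gh].
  by rewrite ffunE mulVg eqxx mulr1 addr0.
by rewrite ffunE -eq_mulVg1 (negPf gh) mulr0.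
Qed.
Fact galg_mulDl : left_distributive galg_mul +%R.
Proof.
move=> x y z; apply/ffunP => h; rewrite !ffunE -big_split.
by apply: eq_bigr => g _; rewrite ffunE mulrDl.
Qed.
Fact galg_mulDr : right_distributive galg_mul +%R.
Proof.
move=> x y z; apply/ffunP => h; rewrite !ffunE -big_split.
by apply: eq_bigr => g _; rewrite ffunE mulrDr.
Qed.

Fact galg_oner_neq0 : galg_one != 0.
Proof.
by apply/eqP => /ffunP/(_ 1%g)/eqP; rewrite !ffunE eqxx oner_eq0.
Qed.

HB.instance Definition _ := GRing.Zmodule_isNzRing.Build group_alg
  galg_mulA galg_mul1l galg_mul1r galg_mulDl galg_mulDr galg_oner_neq0.

Fact galg_scaleAl (c : K) x y : c *: (x * y) = (c *: x) * y.
Proof.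
apply/ffunP => h; rewrite !ffunE scaler_sumr.
by apply: eq_bigr => g _; rewrite ffunE scalerAl.
Qed.

HB.instance Definition _ := GRing.Lmodule_isLalgebra.Build K group_alg
  galg_scaleAl.

Fact galg_scaleAr (c : K) x y : c *: (x * y) = x * (c *: y).
Proof.
apply/ffunP => h; rewrite !ffunE scaler_sumr.
by apply: eq_bigr => g _; rewrite ffunE scalerAr.
Qed.

HB.instance Definition _ := GRing.Lalgebra_isAlgebra.Build K group_alg
  galg_scaleAr.

HB.instance Definition _ := Algebra_isFalgebra.Build K group_alg.

End GroupAlgebra.

Section StarProduct.

Local Open Scope group_scope.

Definition right_kernel (F G : finGroupType) (U : {group F * G}) : {set G} :=
  [set g | (1, g) \in U].

Definition left_kernel (F G : finGroupType) (U : {group F * G}) : {set F} :=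
  [set f | (f, 1) \in U].

Definition star_set (F G H : finGroupType)
    (U : {group F * G}) (V : {group G * H}) : {set F * H} :=
  [set x | [exists g : G, ((x.1, g) \in U) && ((g, x.2) \in V)]].

Lemma star_group_set (F G H : finGroupType)
  (U : {group F * G}) (V : {group G * H}) : group_set (star_set U V).
Proof.
apply/group_setP; split => [|[f h] [f' h']].
  by rewrite inE; apply/existsP; exists 1; rewrite !group1.
rewrite !inE => /existsP[g /andP[/= Ug Vg]] /existsP[g' /andP[/= Ug' Vg']].
apply/existsP; exists (g * g').
by apply/andP; split; [exact: (groupM Ug Ug') | exact: (groupM Vg Vg')].
Qed.

Definition star (F G H : finGroupType)
    (U : {group F * G}) (V : {group G * H}) : {group F * H} :=
  Group (star_group_set U V).

Definition diag_set (G : finGroupType) : {set G * G} := [set x | x.1 == x.2].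

Lemma diag_group_set (G : finGroupType) : group_set (diag_set G).
Proof.
apply/group_setP; split => [|[f h] [f' h']]; first by rewrite inE.
by rewrite !inE /= => /eqP-> /eqP->.
Qed.

Definition diag (G : finGroupType) : {group G * G} := Group (diag_group_set G).

Lemma starP (F G H : finGroupType) (U : {group F * G}) (V : {group G * H}) f h :
  reflect (exists2 g, (f, g) \in U & (g, h) \in V) ((f, h) \in star U V).
Proof.
rewrite inE; apply: (iffP existsP) => [[g /andP[]]|[g Ug Vg]]; exists g => //.
exact/andP.
Qed.

Lemma starA (F G H L : finGroupType)
    (U : {group F * G}) (V : {group G * H}) (W : {group H * L}) :
  star U (star V W) = star (star U V) W.
Proof.
apply/val_inj/setP => -[f l] /=; apply/starP/starP.
  by case=> g Ug /starP[h Vh Wh]; exists h => //; apply/starP; exists g.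
by case=> h /starP[g Ug Vh] Wh; exists g => //; apply/starP; exists h.
Qed.

Lemma star1l (F G : finGroupType) (U : {group F * G}) : star (diag F) U = U.
Proof.
apply/val_inj/setP => -[f g] /=; apply/starP/idP => [[h]|Ug].
  by rewrite inE => /eqP /= ->.
by exists f; rewrite ?inE.
Qed.

Lemma star1r (F G : finGroupType) (U : {group F * G}) : star U (diag G) = U.
Proof.
apply/val_inj/setP => -[f g] /=; apply/starP/idP => [[h Uh]|Ug].
  by rewrite inE => /eqP /= <-.
by exists g; rewrite ?inE.
Qed.

Definition ker_card (F G H : finGroupType)
    (U : {group F * G}) (V : {group G * H}) : nat :=
  #|right_kernel U :&: left_kernel V|.

Lemma ker_card_gt0 (F G H : finGroupType)
    (U : {group F * G}) (V : {group G * H}) : (0 < ker_card U V)%N.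
Proof. by apply/card_gt0P; exists 1; rewrite !inE !group1. Qed.

Lemma ker_cardA (F G H L : finGroupType)
    (U : {group F * G}) (V : {group G * H}) (W : {group H * L}) :
  (ker_card U V * ker_card (star U V) W
   = ker_card U (star V W) * ker_card V W)%N.
Proof.
pose P := [set x : G * H | [&& (1, x.1) \in U, x \in V & (x.2, 1) \in W]].
have gP : group_set P.
  apply/group_setP; split => [|[g h] [g' h']]; first by rewrite inE /= !group1.
  rewrite !inE /= => /and3P[Ug Vg Wg] /and3P[Ug' Vg' Wg'].
  apply/and3P; split.
  - by have := groupM Ug Ug'; rewrite -[(1, g) * _]/(1 * 1, _) mulg1.
  - exact: (groupM Vg Vg').
  by have := groupM Wg Wg'; rewrite -[(h, 1) * _]/(_, 1 * 1) mulg1.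
pose Pg := Group gP.
have imP (aT rT : finGroupType) (f : {morphism [set: aT] >-> rT})
    (Q : {group aT}) :
    (#|'ker_Q f| * #|f @: Q| = #|Q|)%N.
  by rewrite -morphimEsub ?subsetT // card_morphim setTI LagrangeI.
have inl (g : G) : ((g, 1) \in Pg) = (g \in right_kernel U :&: left_kernel V).
  by rewrite !inE /= group1 andbT.
have inr (h : H) : ((1, h) \in Pg) = (h \in right_kernel V :&: left_kernel W).
  by rewrite !inE /= group1.
have snd_im : @snd G H @: Pg = right_kernel (star U V) :&: left_kernel W.
  apply/setP => h; rewrite !inE /=; apply/imsetP/andP => [[[g h'] Pgh ->]|].
    move: Pgh; rewrite inE => /and3P[/= Ug Vg Wh]; split => //.
    by apply/existsP; exists g; rewrite Ug.
  case=> /existsP[g /andP[/= Ug Vg]] Wh; exists (g, h) => //.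
  by rewrite inE /= Ug Vg.
have fst_im : @fst G H @: Pg = right_kernel U :&: left_kernel (star V W).
  apply/setP => g; rewrite !inE /=; apply/imsetP/andP => [[[g' h] Pgh ->]|].
    move: Pgh; rewrite inE => /and3P[/= Ug Vg Wh]; split => //.
    by apply/existsP; exists h; rewrite Vg.
  case=> Ug /existsP[h /andP[/= Vg Wh]]; exists (g, h) => //.
  by rewrite inE /= Ug Vg.
have snd_ker : #|'ker_Pg (@snd G H)| = ker_card U V.
  rewrite /ker_card -[RHS](card_imset _ (can_inj (fun g : G => erefl g : (g, 1 : H).1 = g))).
  apply: eq_card => -[g h]; apply/setIP/imsetP => [[Pgh]|[g' Kg [-> ->]]].
    rewrite !inE /= => /eqP h1; exists g; last by rewrite h1.
    by rewrite -inl -h1.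
  by split; [rewrite inl | rewrite !inE /=].
have fst_ker : #|'ker_Pg (@fst G H)| = ker_card V W.
  rewrite /ker_card -[RHS](card_imset _ (can_inj (fun h : H => erefl h : (1 : G, h).2 = h))).
  apply: eq_card => -[g h]; apply/setIP/imsetP => [[Pgh]|[h' Kh [-> ->]]].
    rewrite !inE /= => /eqP g1; exists h; last by rewrite g1.
    by rewrite -inr -g1.
  by split; [rewrite inr | rewrite !inE /=].
have := imP _ _ [morphism of (@snd G H)] Pg.
have := imP _ _ [morphism of (@fst G H)] Pg.
rewrite /= snd_im fst_im snd_ker fst_ker => <- ->.
exact: mulnC.
Qed.

End StarProduct.

(* Monoid homomorphisms from the positive integers to the non-zero elements of
   K; the value at 0 is never used. *)
Record posnat_hom (K : fieldType) : Type := PosnatHom {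
  posnat_fun :> nat -> K;
  posnat_hom1 : posnat_fun 1%N = 1;
  posnat_homM : forall m n, (0 < m)%N -> (0 < n)%N ->
    posnat_fun (m * n)%N = posnat_fun m * posnat_fun n;
  posnat_hom_neq0 : forall n, (0 < n)%N -> posnat_fun n != 0
}.

Section Lambda.

(* The non-empty finite set of groups is enumerated as G 0, ..., G m; distinct
   indices count as distinct elements, even when the groups are isomorphic. *)
Variables (K : fieldType) (m : nat) (G : 'I_m.+1 -> finGroupType).
Local Notation I := 'I_m.+1.
Local Notation S i j := {group G i * G j}.

Definition symbol : Type := {i : I & {j : I & S i j}}.

HB.instance Definition _ := Finite.on symbol.

Definition symb (i j : I) (U : S i j) : symbol :=
  Tagged (fun i => {j : I & S i j}) (Tagged (fun j => S i j) U).

(* The argument ell is not used by the carrier: it makes the multiplication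
   inferable from the type. *)
Definition Lambda of posnat_hom K : Type := {ffun symbol -> K^o}.

Variable ell : posnat_hom K.

Local Notation L := (Lambda ell).

HB.instance Definition _ := Vector.on L.

Definition sigma (i j k : I) (U : S i j) (V : S j k) : K :=
  ell (ker_card U V).

Definition basis_elt (i j : I) (U : S i j) : L :=
  [ffun t => (t == symb U)%:R].

Definition Lambda_one : L := \sum_(i : I) basis_elt (diag (G i)).

(* Lambda_coef x y W is the coefficient of basis_elt W in the product of x and
   y; basis_eltM and basis_eltM0 give the products of basis elements. *)
Definition Lambda_coef (x y : L) (i k : I) (W : S i k) : K :=
  \sum_(j : I) \sum_(U : S i j) \sum_(V : S j k | star U V == W)
    x (symb U) * y (symb V) * sigma U V.

Definition Lambda_mul (x y : L) : L :=
  [ffun t => Lambda_coef x y (tagged (tagged t))].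

Implicit Types x y z : L.

Lemma symb_ind (P : symbol -> Prop) :
  (forall i j (U : S i j), P (symb U)) -> forall t, P t.
Proof. by move=> IH [i [j U]]; apply: IH. Qed.

Lemma symb_inj i j : injective (@symb i j).
Proof.
move=> U V /eqP; rewrite eq_Tagged => /eqP /eqP.
by rewrite eq_Tagged => /eqP.
Qed.

Lemma Lambda_mulE x y i k (W : S i k) :
  Lambda_mul x y (symb W) = Lambda_coef x y W.
Proof. by rewrite ffunE. Qed.

Lemma basis_eltT i j (U : S i j) t : basis_elt U t = (t == symb U)%:R.
Proof. exact: ffunE. Qed.

Lemma Lambda_scaleE (c : K) x t : (c *: x) t = c * x t.
Proof. exact: ffunE. Qed.

Lemma sigmaA i j k l (U : S i j) (V : S j k) (W : S k l) :
  sigma U V * sigma (star U V) W = sigma U (star V W) * sigma V W.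
Proof. by rewrite /sigma -!posnat_homM ?ker_card_gt0 // ker_cardA. Qed.

Lemma sigma1l i j (V : S i j) : sigma (diag (G i)) V = 1.
Proof.
rewrite /sigma /ker_card (_ : _ :&: _ = 1%g) ?cards1 ?posnat_hom1 //.
apply/setP => g; rewrite !inE /= eq_sym.
by case: eqP => [->|] //; rewrite group1.
Qed.

Lemma sigma1r i j (U : S i j) : sigma U (diag (G j)) = 1.
Proof.
rewrite /sigma /ker_card (_ : _ :&: _ = 1%g) ?cards1 ?posnat_hom1 //.
apply/setP => g; rewrite !inE /= andbC.
by case: eqP => [->|] //; rewrite group1.
Qed.

Fact Lambda_mulA : associative Lambda_mul.
Proof.
move=> x y z; apply/ffunP; apply: symb_ind => i l T; rewrite !Lambda_mulE.
transitivity (\sum_j \sum_k \sum_(U : S i j) \sum_(V : S j k)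
  \sum_(W : S k l | star U (star V W) == T)
    x (symb U) * y (symb V) * z (symb W) * (sigma V W * sigma U (star V W))).
  apply: eq_bigr => j _; rewrite [RHS]exchange_big; apply: eq_bigr => U _ /=.
  under eq_bigr => Q _ do rewrite Lambda_mulE mulr_sumr mulr_suml.
  rewrite exchange_big; apply: eq_bigr => k _ /=.
  under eq_bigr => Q _ do rewrite mulr_sumr mulr_suml.
  rewrite exchange_big; apply: eq_bigr => V _ /=.
  under eq_bigr => Q _ do rewrite mulr_sumr mulr_suml.
  rewrite (exchange_big_dep (fun W => star U (star V W) == T)) /=; last first.
    by move=> Q W /eqP QT /eqP VW; rewrite VW QT.
  apply: eq_bigr => W WT; rewrite (big_pred1 (star V W)) => [|Q].
    by rewrite !mulrA.
  by rewrite /= [RHS]eq_sym; case: (star V W =P Q) => [<-|]; rewrite ?WT ?andbF.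
rewrite exchange_big; apply: eq_bigr => k _ /=.
under [RHS]eq_bigr => Q _.
  under eq_bigr => W _ do rewrite Lambda_mulE !mulr_suml.
  over.
rewrite /=.
under [RHS]eq_bigr => Q _ do rewrite exchange_big.
rewrite /= [RHS]exchange_big; apply: eq_bigr => j _ /=.
under [RHS]eq_bigr => Q _ do
  under eq_bigr => W _ do rewrite !mulr_suml.
under [RHS]eq_bigr => Q _ do rewrite exchange_big.
rewrite /= [RHS]exchange_big; apply: eq_bigr => U _ /=.
under [RHS]eq_bigr => Q _ do
  under eq_bigr => W _ do rewrite !mulr_suml big_mkcond.
under [RHS]eq_bigr => Q _ do rewrite exchange_big.
rewrite /= [RHS]exchange_big; apply: eq_bigr => V _ /=.
rewrite (bigD1 (star U V)) //= [X in _ + X]big1 ?addr0 => [|Q QUV]; last first.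
  by rewrite big1 // => W _; rewrite eq_sym (negPf QUV).
rewrite eqxx; apply: eq_big => W; first by rewrite starA.
by move=> _; rewrite -!mulrA; congr (_ * (_ * _));
   rewrite [RHS]mulrCA sigmaA [sigma U (star V W) * _]mulrC.
Qed.

Lemma basis_eltE i j (U V : S i j) : basis_elt U (symb V) = (U == V)%:R.
Proof.
by rewrite ffunE; congr ((nat_of_bool _)%:R); apply/eqP/eqP => [/symb_inj|->].
Qed.

Lemma basis_elt_neq i j i' j' (U : S i j) (V : S i' j') :
  (i, j) != (i', j') -> basis_elt U (symb V) = 0.
Proof.
move=> neq; rewrite ffunE; case: eqP => // VU.
by case/eqP: neq; rewrite -[i]/(tag (symb U)) -[j]/(tag (tagged (symb U))) -VU.
Qed.

Lemma Lambda_oneE i j (U : S i j) :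
  Lambda_one (symb U) = (symb U == symb (diag (G i)))%:R.
Proof.
rewrite sum_ffunE (bigD1 i) //= big1 => [|k ki]; first by rewrite addr0 ffunE.
by apply: basis_elt_neq; rewrite xpair_eqE (negPf ki).
Qed.

Fact Lambda_mul1l : left_id Lambda_one Lambda_mul.
Proof.
move=> x; apply/ffunP; apply: symb_ind => i k W; rewrite Lambda_mulE.
rewrite /Lambda_coef (bigD1 i) //= [X in _ + X]big1 => [|j ji]; last first.
  rewrite big1 // => U _; rewrite big1 // => V _.
  rewrite Lambda_oneE; case: eqP => [eqU|]; last by rewrite !mul0r.
  case/eqP: ji.
  by rewrite -[j]/(tag (tagged (symb U))) eqU.
rewrite addr0 (bigD1 (diag (G i))) //= [X in _ + X]big1 => [|U neqU]; last first.
  rewrite big1 // => V _; rewrite Lambda_oneE.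
  by case: eqP => [/symb_inj/eqP|]; rewrite ?(negPf neqU) // !mul0r.
rewrite addr0 (big_pred1 W) => [|V]; last by rewrite star1l.
by rewrite Lambda_oneE eqxx mul1r sigma1l mulr1.
Qed.
Fact Lambda_mul1r : right_id Lambda_one Lambda_mul.
Proof.
move=> x; apply/ffunP; apply: symb_ind => i k W; rewrite Lambda_mulE.
rewrite /Lambda_coef (bigD1 k) //= [X in _ + X]big1 => [|j jk]; last first.
  rewrite big1 // => U _; rewrite big1 // => V _.
  rewrite Lambda_oneE; case: eqP => [eqV|]; last by rewrite mulr0 mul0r.
  case/eqP: jk.
  by rewrite -[k in _ = k]/(tag (tagged (symb V))) eqV.
rewrite addr0 (bigD1 W) //= [X in _ + X]big1 => [|U neqU]; last first.
  rewrite big1 // => V /eqP UV; rewrite Lambda_oneE.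
  case: eqP => [/symb_inj VD|]; last by rewrite mulr0 mul0r.
  by case/eqP: neqU; rewrite -UV VD star1r.
rewrite addr0 (bigD1 (diag (G k))) ?star1r //= big1 => [|V /andP[_ neqV]].
  by rewrite Lambda_oneE eqxx mulr1 sigma1r mulr1 addr0.
rewrite Lambda_oneE.
by case: eqP => [/symb_inj/eqP|]; rewrite ?(negPf neqV) // mulr0 mul0r.
Qed.
Fact Lambda_mulDl : left_distributive Lambda_mul +%R.
Proof.
move=> x y z; apply/ffunP; apply: symb_ind => i k W.
rewrite [RHS]ffunE !Lambda_mulE.
rewrite -big_split; apply: eq_bigr => j _ /=.
rewrite -big_split; apply: eq_bigr => U _ /=.
by rewrite -big_split; apply: eq_bigr => V _; rewrite ffunE !mulrDl.
Qed.
Fact Lambda_mulDr : right_distributive Lambda_mul +%R.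
Proof.
move=> x y z; apply/ffunP; apply: symb_ind => i k W.
rewrite [RHS]ffunE !Lambda_mulE.
rewrite -big_split; apply: eq_bigr => j _ /=.
rewrite -big_split; apply: eq_bigr => U _ /=.
by rewrite -big_split; apply: eq_bigr => V _; rewrite ffunE mulrDr !mulrDl.
Qed.
Fact Lambda_oner_neq0 : Lambda_one != 0.
Proof.
apply/eqP => /ffunP/(_ (symb (diag (G ord0))))/eqP.
by rewrite Lambda_oneE eqxx ffunE oner_eq0.
Qed.

HB.instance Definition _ := GRing.Zmodule_isNzRing.Build L
  Lambda_mulA Lambda_mul1l Lambda_mul1r Lambda_mulDl Lambda_mulDr
  Lambda_oner_neq0.

Fact Lambda_scaleAl (c : K) x y : c *: (x * y) = (c *: x) * y.
Proof.
apply/ffunP; apply: symb_ind => i k W; rewrite !ffunE.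
rewrite scaler_sumr; apply: eq_bigr => j _.
rewrite scaler_sumr; apply: eq_bigr => U _.
by rewrite scaler_sumr; apply: eq_bigr => V _; rewrite ffunE !scalerAl.
Qed.

HB.instance Definition _ := GRing.Lmodule_isLalgebra.Build K L
  Lambda_scaleAl.

Fact Lambda_scaleAr (c : K) x y : c *: (x * y) = x * (c *: y).
Proof.
apply/ffunP; apply: symb_ind => i k W; rewrite !ffunE.
rewrite scaler_sumr; apply: eq_bigr => j _.
rewrite scaler_sumr; apply: eq_bigr => U _.
rewrite scaler_sumr; apply: eq_bigr => V _.
by rewrite ffunE scalerAl scalerAr.
Qed.

HB.instance Definition _ := GRing.Lalgebra_isAlgebra.Build K L
  Lambda_scaleAr.

HB.instance Definition _ := Algebra_isFalgebra.Build K L.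

Lemma Lambda_coefE x y i j k (U : S i j) (V : S j k) i' k' (W : S i' k') :
  (forall j' (U' : S i' j') (V' : S j' k'),
     x (symb U') * y (symb V')
       = (symb U' == symb U)%:R * (symb V' == symb V)%:R) ->
  Lambda_coef x y W = sigma U V * (symb W == symb (star U V))%:R.
Proof.
move=> xyE; rewrite /Lambda_coef.
under eq_bigr => j' _ do under eq_bigr => U' _ do
  under eq_bigr => V' _ do rewrite xyE.
have [WUV|nWUV] := eqVneq (symb W) (symb (star U V)).
  have [ei ek] : i' = i /\ k' = k.
    split; first exact: (congr1 tag WUV).
    exact: (congr1 (fun t : symbol => tag (tagged t)) WUV).
  case: _ / (esym ei) W xyE WUV => W; case: _ / (esym ek) W => W _ /symb_inj ->.
  rewrite (bigD1 j) //= [X in _ + X]big1 => [|j' jj']; last first.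
    apply: big1 => U' _; apply: big1 => V' _; case: eqP => [eqU|_].
      case/eqP: jj'; exact: (congr1 (fun t : symbol => tag (tagged t)) eqU).
    by rewrite !mul0r.
  rewrite addr0 (bigD1 U) //= [X in _ + X]big1 => [|U' UU']; last first.
    apply: big1 => V' _; case: eqP => [/symb_inj eqU|_].
      by case/eqP: UU'.
    by rewrite !mul0r.
  rewrite addr0 (bigD1 V) //= big1 => [|V' /andP[_ VV']].
    by rewrite !eqxx !mulr1 mul1r addr0.
  case: (symb V' =P symb V) => [/symb_inj eqV|_]; first by case/eqP: VV'.
  by rewrite mulr0 mul0r.
rewrite mulr0; apply: big1 => j' _; apply: big1 => U' _; apply: big1 => V' UV'.
case: eqP => [eqU|_]; last by rewrite !mul0r.
case: eqP => [eqV|_]; last by rewrite mulr0 mul0r.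
case/eqP: nWUV.
have ei : i' = i := congr1 tag eqU.
have ej : j' = j := congr1 (fun t : symbol => tag (tagged t)) eqU.
have ek : k' = k := congr1 (fun t : symbol => tag (tagged t)) eqV.
case: _ / (esym ei) W U' eqU UV' {xyE} => W U'.
case: _ / (esym ek) W V' eqV => W V'.
case: _ / (esym ej) U' V' => U' V' /symb_inj-> /symb_inj->.
by move/eqP->.
Qed.

Lemma basis_eltM i j k (U : S i j) (V : S j k) :
  basis_elt U * basis_elt V = sigma U V *: basis_elt (star U V).
Proof.
apply/ffunP; apply: symb_ind => i' k' W.
rewrite [LHS]Lambda_mulE [RHS]Lambda_scaleE basis_eltT.
apply: Lambda_coefE => j' U' V'.
exact: (congr2 *%R (basis_eltT _ _) (basis_eltT _ _)).
Qed.

Lemma basis_eltM0 i j j' k (U : S i j) (V : S j' k) :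
  j != j' -> basis_elt U * basis_elt V = 0.
Proof.
move=> jj'; apply/ffunP; apply: symb_ind => i1 k1 W.
rewrite [LHS]Lambda_mulE [RHS]ffunE /Lambda_coef.
apply: big1 => j1 _; apply: big1 => U1 _; apply: big1 => V1 _.
have UV0 : basis_elt U (symb U1) * basis_elt V (symb V1) = 0.
  rewrite (congr2 *%R (basis_eltT U (symb U1)) (basis_eltT V (symb V1))).
  case: eqP => [eqU|_]; last by rewrite mul0r.
  case: eqP => [eqV|_]; last by rewrite mulr0.
  case/eqP: jj'.
  have <- : j1 = j := congr1 (fun t : symbol => tag (tagged t)) eqU.
  exact: (congr1 tag eqV).
exact: etrans (congr1 ( *%R^~ _) UV0) (mul0r _).
Qed.

End Lambda.

Definition factor_group (S R : finGroupType) : Prop :=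
  exists M N : {group R}, (N <| M)%g /\ [set: S] \isog (M / N)%g.

Section FactorGroups.

Variables (m : nat) (G : 'I_m.+1 -> finGroupType).

Definition factor_group_reps (J : finType) (E : J -> finGroupType) : Prop :=
  [/\ forall j, exists i, factor_group (E j) (G i),
      forall (S : finGroupType) i, factor_group S (G i) ->
        exists j, [set: S] \isog [set: E j]
    & forall j j', [set: E j] \isog [set: E j'] -> j = j'].

(* The triple (G i, B, Y) is encoded as the pair (B, Y) tagged by i. *)
Definition triple : finType := {i : 'I_m.+1 & ({group G i} * {group G i})%type}.

Definition factor_triples (E : finGroupType) : {set triple} :=
  [set t : triple | let: (B, Y) := tagged t in
    (Y <| B)%g && (B / Y \isog [set: E])%g].

End FactorGroups.

(* Multiplication in Aut is composition in diagrammatic order; inversion is an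
   isomorphism onto the group with the opposite convention. *)
Definition Aut_type (E : finGroupType) : finGroupType :=
  subg_of (Aut_group [set: E]).

(* Main.v *)
Require Import Defs.
From HB Require Import structures.
From mathcomp Require Import all_boot all_order all_algebra all_fingroup falgebra.

Import GRing.Theory.
Set Implicit Arguments.
Unset Strict Implicit.
Unset Printing Implicit Defensive.

(** A subgroup V of G x E is called a chart of G with values in E when it is
    the graph of an epimorphism onto E from a subgroup B of G. With Y the
    kernel of the epimorphism, B / Y is isomorphic to E. The automorphisms of E
    act on the right of the charts by composition; two charts are in the same
    orbit exactly when they have the same section (B, Y) ([chart_torsor]), and
    the action is free ([chart_aut_inj]). Hence the charts with values in E,
    over all groups G i, are the pairs of a triple (i, B, Y) with B / Y
    isomorphic to E and an automorphism of E ([sum_charts]).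

    Lambda acts on the left of the span of the charts with values in E:
    s_U sends a chart V to a multiple of star U V, read as 0 when star U V is
    not a chart. This is an action because star U V can only be a chart if V is
    ([chart_cofactor]), and because the factors sigma form a cocycle
    ([posnat_ker_cardA]). It commutes with Aut E, so that it is a representation
    on a free module over the group algebra of Aut E, of rank the number n_E of
    triples: an algebra morphism from Lambda to Mat_(n_E) (K Aut E)
    ([chart_rep], [chart_repM]). The product of these morphisms over the
    representatives E is [chart_reps].

    An element x of the joint kernel strictly lowers a numerical rank: a
    subgroup V factors through a chart T of its left section, and when W has at
    least the rank of V, the coefficient of s_W in x s_V is either an empty sum
    or a coefficient of x acting on T, hence 0 ([act_coef_eq0]). So x is not a
    nonzero idempotent
    ([kernel_idempotent]). Since a nonzero left ideal of a semisimple algebra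
    contains a nonzero idempotent ([semisimple_idempotent]), [chart_reps] is
    injective.

    Surjectivity is a matter of dimensions. Sending the matrix unit (s, t),
    scaled by the automorphism a, to the basis element of the subgroup
    V_s a V_t^-1 embeds the sum of matrix algebras linearly in Lambda
    ([mxunit_embed_inj]); composing with [chart_reps] gives an injective
    endomorphism of Lambda, thus a bijective one. A bijective
    multiplicative map preserves 1. *)

(** * Subgroups of direct products as relations *)

Local Open Scope group_scope.

Section Converse.

Variables F G : finGroupType.
Implicit Types U : {group F * G}.

Definition converse_set U : {set G * F} := [set x | (x.2, x.1) \in U].

Lemma converse_group_set U : group_set (converse_set U).
Proof.
apply/group_setP; split => [|[g f] [g' f']]; first by rewrite inE group1.
by rewrite !inE => /= gU g'U; exact: (groupM gU g'U).
Qed.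

Definition converse U : {group G * F} := Group (converse_group_set U).

Lemma converseE U g f : ((g, f) \in converse U) = ((f, g) \in U).
Proof. by rewrite inE. Qed.

End Converse.

Lemma converseK (F G : finGroupType) (U : {group F * G}) :
  converse (converse U) = U.
Proof. by apply/val_inj/setP => -[f g]; rewrite !inE. Qed.

Lemma converse_star (F G H : finGroupType) (U : {group F * G})
    (V : {group G * H}) :
  converse (star U V) = star (converse V) (converse U).
Proof.
apply/val_inj/setP => -[h f] /=; rewrite converseE; apply/starP/starP.
  by case=> g Ug Vg; exists g; rewrite converseE.
by case=> g; rewrite !converseE => Vg Ug; exists g.
Qed.

Lemma pairM (F G : finGroupType) (U : {group F * G}) f f' g g' :
  (f, g) \in U -> (f', g') \in U -> (f * f', g * g') \in U.
Proof. exact: groupM. Qed.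

Lemma pairV (F G : finGroupType) (U : {group F * G}) f g :
  (f, g) \in U -> (f^-1, g^-1) \in U.
Proof. by rewrite -groupV. Qed.

(** Subgroups are difunctional relations, by the identity
    f = f * f'^-1 * f'. *)
Lemma pair_trans (F G : finGroupType) (U : {group F * G}) f f' g g' :
  (f, g) \in U -> (f', g) \in U -> (f', g') \in U -> (f, g') \in U.
Proof.
move=> Ufg Uf'g Uf'g'.
by have := pairM (pairM Ufg (pairV Uf'g)) Uf'g'; rewrite mulgV mulgKV mul1g.
Qed.

Lemma star_converseK (F G : finGroupType) (U : {group F * G}) :
  star (star U (converse U)) U = U.
Proof.
apply/val_inj/setP => -[f g] /=; apply/starP/idP.
  case=> f' /starP[g' Ufg' +] Uf'g; rewrite converseE => Uf'g'.
  exact: pair_trans Ufg' Uf'g' Uf'g.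
by move=> Ufg; exists f => //; apply/starP; exists g; rewrite ?converseE.
Qed.

Section LeftSection.

Variables F G : finGroupType.
Implicit Types U : {group F * G}.

Definition left_domain_set U : {set F} := [set f | [exists g, (f, g) \in U]].

Lemma left_domain_group_set U : group_set (left_domain_set U).
Proof.
apply/group_setP; split => [|f f'].
  by rewrite inE; apply/existsP; exists 1; rewrite group1.
rewrite !inE => /existsP[g Ug] /existsP[g' Ug'].
by apply/existsP; exists (g * g'); exact: pairM.
Qed.

Definition left_domain U : {group F} := Group (left_domain_group_set U).

Lemma left_kernel_group_set U : group_set (left_kernel U).
Proof.
apply/group_setP; split => [|f f']; first by rewrite inE group1.
by rewrite !inE => Uf Uf'; rewrite -[1]mulg1; exact: pairM.
Qed.

Definition left_kernel_group U : {group F} := Group (left_kernel_group_set U).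

(** One of the two sections that U identifies, in Goursat's description of the
    subgroups of a direct product. *)
Definition left_section U : {group F} * {group F} :=
  (left_domain U, left_kernel_group U).

Lemma left_domainP U f : reflect (exists g, (f, g) \in U) (f \in left_domain U).
Proof. by rewrite inE; exact: existsP. Qed.

Lemma left_kernelE U f : (f \in left_kernel_group U) = ((f, 1) \in U).
Proof. by rewrite inE. Qed.

Lemma left_kernel_normal U : left_kernel_group U <| left_domain U.
Proof.
apply/andP; split.
  by apply/subsetP => f; rewrite left_kernelE => Uf; apply/left_domainP; exists 1.
apply/subsetP => f /left_domainP[g Ug]; rewrite inE.
apply/subsetP => _ /imsetP[y Uy ->]; move: Uy; rewrite !left_kernelE => Uy.
by have := pairM (pairV Ug) (pairM Uy Ug); rewrite mul1g mulVg.
Qed.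

End LeftSection.

Lemma star_converseE (F G : finGroupType) (U : {group F * G}) f f' :
  ((f, f') \in star U (converse U)) =
  [&& f \in left_domain U, f' \in left_domain U
    & f * f'^-1 \in left_kernel_group U].
Proof.
rewrite left_kernelE; apply/starP/and3P.
  case=> g Ufg; rewrite converseE => Uf'g; split.
  - by apply/left_domainP; exists g.
  - by apply/left_domainP; exists g.
  by have := pairM Ufg (pairV Uf'g); rewrite mulgV.
case=> _ /left_domainP[g Uf'g] Uff'; exists g; last by rewrite converseE.
by have := pairM Uff' Uf'g; rewrite mulgKV mul1g.
Qed.

(** star U (converse U) is the relation of congruence modulo the kernel on the
    domain, so that it carries the same information as the section. The
    equation on the right is the form used in computations with star. *)
Lemma left_sectionP (F G H : finGroupType) (U : {group F * G})
    (V : {group F * H}) :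
  left_section U = left_section V <->
  star U (converse U) = star V (converse V).
Proof.
split=> [UV | UV].
  apply/val_inj/setP => -[f f']; rewrite !star_converseE.
  have -> : left_domain U = left_domain V := congr1 fst UV.
  by have -> : left_kernel_group U = left_kernel_group V := congr1 snd UV.
have UVE f f' : ((f, f') \in star U (converse U)) =
                ((f, f') \in star V (converse V)) by rewrite UV.
congr (_, _); apply/val_inj/setP => f.
  have /= := UVE f f; rewrite !star_converseE mulgV !group1 !andbT !andbb.
  by [].
have := UVE f 1; rewrite !star_converseE !group1 invg1 mulg1 /=.
have sub (A : finGroupType) (W : {group F * A}) :
    (f \in left_domain W) && (f \in left_kernel_group W)
    = (f \in left_kernel_group W).
  by apply: andb_idl; apply: subsetP; exact: normal_sub (left_kernel_normal W).
by rewrite !sub.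
Qed.

(** star U V depends on U only through star U (V * converse V), which the left
    section of V determines. *)
Lemma eq_star_left_section (F G H L : finGroupType) (U U' : {group F * G})
    (V : {group G * H}) (W : {group G * L}) :
  left_section V = left_section W ->
  star U V = star U' V -> star U W = star U' W.
Proof.
move=> /left_sectionP VW UV.
by rewrite -(star_converseK W) -VW !starA UV.
Qed.

Lemma ker_card_left_section (F G H L : finGroupType) (U : {group F * G})
    (V : {group G * H}) (W : {group G * L}) :
  left_section V = left_section W -> ker_card U V = ker_card U W.
Proof.
move=> VW; rewrite /ker_card.
have /= -> // := congr1 (fun x : {group G} * {group G} => val x.2) VW.
Qed.

(** * Charts *)

Section Chart.

Variable E : finGroupType.

(** The equation says that the converse is total and that V is
    functional. *)
Definition chart (G : finGroupType) (V : {group G * E}) : bool :=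
  star (converse V) V == diag E.

Lemma chartP (G : finGroupType) (V : {group G * E}) :
  reflect ((forall e, exists g, (g, e) \in V) /\
           (forall e, (1, e) \in V -> e = 1)) (chart V).
Proof.
apply: (iffP eqP) => [VE | [Vtot Vfun]].
  split=> e.
    have : (e, e) \in star (converse V) V by rewrite VE inE.
    by case/starP=> g _; exists g.
  move=> Ve; have : (1, e) \in star (converse V) V.
    by apply/starP; exists 1; rewrite ?group1.
  by rewrite VE inE => /eqP.
apply/val_inj/setP => -[e e'] /=; rewrite [RHS]inE /=.
apply/starP/eqP => [[g]|<-].
  rewrite converseE => Ve Ve'; apply/eqP; rewrite eq_mulgV1; apply/eqP/Vfun.
  by rewrite -(mulgV g); exact: pairM Ve (pairV Ve').
by have [g Vg] := Vtot e; exists g; rewrite ?converseE.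
Qed.

Lemma chart_fun (G : finGroupType) (V : {group G * E}) g e e' :
  chart V -> (g, e) \in V -> (g, e') \in V -> e = e'.
Proof.
move=> /eqP VE Ve Ve'; have : (e, e') \in star (converse V) V.
  by apply/starP; exists g; rewrite ?converseE.
by rewrite VE inE => /eqP.
Qed.

(** The subgroups that are not charts thus span a submodule, which justifies
    dropping them in the action on charts. *)
Lemma chart_cofactor (F G : finGroupType) (U : {group F * G})
    (V : {group G * E}) : chart (star U V) -> chart V.
Proof.
case/chartP=> UVtot UVfun; apply/chartP; split=> e.
  by have [f /starP[g _ Vg]] := UVtot e; exists g.
by move=> Ve; apply: UVfun; apply/starP; exists 1; rewrite ?group1.
Qed.

Lemma chart_section_isog (G : finGroupType) (V : {group G * E}) :
  chart V -> left_domain V / left_kernel_group V \isog [set: E].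
Proof.
move=> cV; pose f g := odflt 1 [pick e | (g, e) \in V].
have fE g e : (g, e) \in V -> f g = e.
  move=> Ve; rewrite /f; case: pickP => [e' Ve'|/(_ e)]; last by rewrite Ve.
  exact: chart_fun Ve' Ve.
have fM : {in left_domain V &, {morph f : x y / x * y}}.
  move=> x y /left_domainP[e Ve] /left_domainP[e' Ve'].
  by rewrite (fE _ _ Ve) (fE _ _ Ve') (fE _ _ (pairM Ve Ve')).
have := first_isog (Morphism fM); set ff := Morphism fM.
have -> : ff @* left_domain V = setT.
  apply/eqP; rewrite eqEsubset subsetT; apply/subsetP => e _.
  have [g Vg] := (chartP _ cV).1 e.
  have Dg : g \in left_domain V by apply/left_domainP; exists e.
  by rewrite -(fE _ _ Vg); exact: (mem_morphim ff Dg Dg).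
suff -> : 'ker ff = left_kernel_group V by [].
apply/setP => g; rewrite left_kernelE; apply/morphpreP/idP.
  case=> /left_domainP[e Ve]; rewrite inE /= (fE _ _ Ve) => /eqP e1.
  by rewrite -e1.
move=> Vg; split; first by apply/left_domainP; exists 1.
by rewrite inE /= (fE _ _ Vg).
Qed.

(** The graph of the composite of the quotient map B -> B / Y with an
    isomorphism onto E. *)
Lemma exists_chart (G : finGroupType) (B Y : {group G}) :
    Y <| B -> B / Y \isog [set: E] ->
  exists2 V : {group G * E}, chart V & left_section V = (B, Y).
Proof.
move=> nYB /isogP[f injf imf]; have nY := subsetP (normal_norm nYB).
pose V := [set x : G * E | (x.1 \in B) && (f (coset Y x.1) == x.2)].
have gV : group_set V.
  apply/group_setP; split=> [|[g e] [g' e']].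
    by rewrite !inE /= group1 !morph1 eqxx.
  rewrite !inE /= => /andP[Bg /eqP <-] /andP[Bg' /eqP <-].
  by rewrite groupM //= morphM ?nY // morphM ?mem_quotient.
have VE g e : ((g, e) \in Group gV) = (g \in B) && (f (coset Y g) == e).
  by rewrite inE.
exists (Group gV).
  apply/chartP; split=> e; last by rewrite VE !morph1 => /andP[_ /eqP].
  have : e \in f @* (B / Y) by rewrite imf inE.
  by case/morphimP=> _ _ /morphimP[g _ Bg ->] ->; exists g; rewrite VE Bg /=.
congr (_, _); apply/val_inj/setP => g.
  apply/left_domainP/idP => [[e]|Bg]; first by rewrite VE => /andP[].
  by exists (f (coset Y g)); rewrite VE Bg /=.
have sYB := subsetP (normal_sub nYB).
rewrite /= [LHS]left_kernelE VE; apply/andP/idP => [[Bg /eqP fg1]|Yg].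
  rewrite coset_idr ?nY //.
  by apply: (injmP injf); rewrite ?mem_quotient ?morph1.
by rewrite sYB // coset_id // morph1.
Qed.

Section AutGraph.

Implicit Type a : Aut_type E.

Definition aut_graph_set a : {set E * E} := [set x | sgval a x.1 == x.2].

Lemma aut_graph_group_set a : group_set (aut_graph_set a).
Proof.
have aM x y : sgval a (x * y) = sgval a x * sgval a y.
  by apply: (morphicP (Aut_morphic (subgP a))); rewrite inE.
apply/group_setP; split => [|[e f] [e' f']]; rewrite !inE /=.
  by rewrite -(inj_eq (mulgI (sgval a 1))) -aM !mulg1.
by move=> /eqP <- /eqP <-; rewrite aM.
Qed.

(** Products in the automorphism group compose from left to right, as star
    does: the graph is a morphism. *)
Definition aut_graph a : {group E * E} := Group (aut_graph_group_set a).

Lemma aut_graphE a e f : ((e, f) \in aut_graph a) = (sgval a e == f).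
Proof. by rewrite inE. Qed.

Lemma aut_graph_inj : injective aut_graph.
Proof.
move=> a b ab; apply/val_inj/permP => e; apply/eqP.
by rewrite -[_ == _]aut_graphE ab aut_graphE eq_sym.
Qed.

Lemma aut_graphM a b : star (aut_graph a) (aut_graph b) = aut_graph (a * b).
Proof.
apply/val_inj/setP => -[e f]; rewrite /= [RHS]aut_graphE.
apply/starP/eqP => [[e']|].
  by rewrite !aut_graphE => /eqP <- /eqP <-; rewrite permM.
by rewrite permM => <-; exists (sgval a e); rewrite aut_graphE.
Qed.

Lemma aut_graph1 : aut_graph 1 = diag E.
Proof.
by apply/val_inj/setP => -[e f]; rewrite /= [LHS]aut_graphE perm1 inE.
Qed.

Lemma converse_aut_graph a : converse (aut_graph a) = aut_graph a^-1.
Proof.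
apply/val_inj/setP => -[e f]; rewrite /= [LHS]converseE !aut_graphE.
by rewrite morphV ?inE ?subgP //= (canF_eq (permK _)) eq_sym.
Qed.

Lemma bijective_aut_graph (D : {group E * E}) :
  chart D -> chart (converse D) -> exists a, D = aut_graph a.
Proof.
move=> cD cD'; pose f e := odflt 1 [pick e' | (e, e') \in D].
have tot e : exists e', (e, e') \in D.
  by have [e' +] := (chartP _ cD').1 e; rewrite converseE; exists e'.
have fE e e' : (e, e') \in D -> f e = e'.
  move=> De; rewrite /f; case: pickP => [e2 De2|/(_ e')]; last by rewrite De.
  exact: chart_fun De2 De.
have fD e : (e, f e) \in D by have [e' De] := tot e; rewrite (fE _ _ De).
have f_inj : injective f.
  move=> e e' eq_f; apply: (chart_fun cD' (g := f e)).
    by rewrite converseE.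
  by rewrite converseE eq_f.
have Af : perm f_inj \in Aut [set: E].
  rewrite inE; apply/andP; split; first by apply/subsetP => e; rewrite inE.
  apply/morphicP => x y _ _; rewrite !permE.
  by apply: fE; exact: pairM.
exists (subg [Aut [set: E]] (perm f_inj)).
apply/val_inj/setP => -[e e'] /=; rewrite aut_graphE subgK // permE.
by apply/idP/eqP => [/fE|<-].
Qed.

Variable G : finGroupType.
Implicit Type V : {group G * E}.

Lemma chart_aut V a : chart V -> chart (star V (aut_graph a)).
Proof.
move=> /eqP cV; rewrite /chart converse_star converse_aut_graph.
by rewrite -starA (starA (converse V)) cV star1l aut_graphM mulVg aut_graph1.
Qed.

Lemma left_section_aut V a :
  left_section (star V (aut_graph a)) = left_section V.
Proof.
apply/left_sectionP; rewrite converse_star converse_aut_graph.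
by rewrite -starA (starA (aut_graph a)) aut_graphM mulgV aut_graph1 star1l.
Qed.

Lemma chart_aut_inj V : chart V -> injective (fun a => star V (aut_graph a)).
Proof.
move=> /eqP cV a b /(congr1 (star (converse V))).
by rewrite !starA cV !star1l => /aut_graph_inj.
Qed.

(** The automorphism is the composite star (converse V) V'. *)
Lemma chart_torsor V V' : chart V -> chart V' ->
  left_section V = left_section V' -> exists a, V' = star V (aut_graph a).
Proof.
move=> /eqP cV /eqP cV' /left_sectionP VV'.
have [||a Da] := @bijective_aut_graph (star (converse V) V').
- rewrite /chart converse_star converseK -starA (starA V) VV' star_converseK.
  by rewrite cV'.
- rewrite /chart converseK converse_star converseK -starA (starA V') -VV'.
  by rewrite star_converseK cV.
by exists a; rewrite -Da starA VV' star_converseK.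
Qed.

End AutGraph.

End Chart.

Section ChartConverse.

Variables (E F G : finGroupType) (V : {group F * E}) (W : {group G * E}).

Lemma left_section_star_converse :
  chart W -> left_section (star V (converse W)) = left_section V.
Proof.
move=> /eqP cW; apply/left_sectionP.
by rewrite converse_star converseK -starA (starA (converse W)) cW star1l.
Qed.

End ChartConverse.

Lemma right_section_star_converse (E F G : finGroupType) (V : {group F * E})
    (W : {group G * E}) :
  chart V -> left_section (converse (star V (converse W))) = left_section W.
Proof.
by move=> cV; rewrite converse_star converseK left_section_star_converse.
Qed.

(** The hypothesis on right sections says that the relation U, sandwiched between
    converse V and V, acts as the identity. As T has the same left section as V,
    multiplying by star (converse T) V and its converse replaces V by T, which
    is the equation that defines charts. *)
Lemma chart_star_right_section (E F G H : finGroupType) (U : {group F * G})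
    (V : {group G * H}) (T : {group G * E}) :
  chart T -> left_section T = left_section V ->
  left_section (converse (star U V)) = left_section (converse V) ->
  chart (star U T).
Proof.
move=> /eqP cT /left_sectionP TV /left_sectionP.
rewrite !converseK converse_star => UV.
have := congr1 (fun X => star (star (star (converse T) V) X)
                           (star (converse V) T)) UV.
have TVV : star (star (converse T) V) (converse V) = converse T.
  by rewrite -starA -TV starA cT star1l.
have VVT : star V (star (converse V) T) = T by rewrite starA -TV star_converseK.
rewrite !starA TVV -!starA !VVT cT => {}UV.
by rewrite /chart converse_star -starA UV.
Qed.

(** Multiplying on the left shrinks the right domain and enlarges the right
    kernel. This number records both, so that it drops as soon as one of them
    changes. *)
Definition right_rank (G H : finGroupType) (V : {group G * H}) : nat :=
  #|left_domain (converse V)| + (#|H| - #|left_kernel_group (converse V)|).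

Lemma right_rank_star (F G H : finGroupType) (U : {group F * G})
    (V : {group G * H}) :
  (right_rank V <= right_rank (star U V))%N ->
  left_section (converse (star U V)) = left_section (converse V).
Proof.
rewrite /right_rank => leVW.
have sD : left_domain (converse (star U V)) \subset left_domain (converse V).
  apply/subsetP => h /left_domainP[f]; rewrite converseE => /starP[g _ Vg].
  by apply/left_domainP; exists g; rewrite converseE.
have sK : left_kernel_group (converse V)
    \subset left_kernel_group (converse (star U V)).
  apply/subsetP => h; rewrite !left_kernelE !converseE => Vh.
  by apply/starP; exists 1%g; rewrite ?group1.
have leD := subset_leq_card sD; have leK := subset_leq_card sK.
have leH : (#|left_kernel_group (converse (star U V))| <= #|H|)%N.
  exact: max_card.
congr (_, _); apply/val_inj/eqP.
  rewrite /= eqEcard sD -(leq_add2r (#|H| - #|left_kernel_group (converse V)|)).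
  by apply: leq_trans leVW _; rewrite leq_add2l leq_sub2l.
rewrite /= eq_sym eqEcard sK /=.
have : (#|H| - #|left_kernel_group (converse V)|
  <= #|H| - #|left_kernel_group (converse (star U V))|)%N.
  by rewrite -(leq_add2l #|left_domain (converse V)|) (leq_trans leVW) //
    leq_add2r.
by rewrite leq_sub2lE.
Qed.

Local Close Scope group_scope.
Local Open Scope ring_scope.

(** * Idempotents of semisimple algebras *)

Section SemisimpleIdeals.

Variables (K : fieldType) (A : falgType K).
Implicit Types L M C : {vspace A}.

Lemma left_idealP L :
  reflect (forall a x, x \in L -> a * x \in L) (left_ideal L).
Proof.
apply: (iffP prodvP) => [idL a x Lx | idL a x _ Lx]; last exact: idL.
by apply: idL; rewrite ?memvf.
Qed.

Lemma left_ideal_cap L M :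
  left_ideal L -> left_ideal M -> left_ideal (L :&: M)%VS.
Proof.
move=> /left_idealP idL /left_idealP idM; apply/left_idealP => a x.
by rewrite !memv_cap => /andP[Lx Mx]; rewrite idL ?idM.
Qed.

Lemma left_ideal_add L M :
  left_ideal L -> left_ideal M -> left_ideal (L + M)%VS.
Proof.
move=> idL idM; rewrite /left_ideal prodvDr.
by rewrite addvS.
Qed.

Lemma left_ideal_sum (I : finType) (P : pred I) (L : I -> {vspace A}) :
  (forall i, left_ideal (L i)) -> left_ideal (\sum_(i | P i) L i)%VS.
Proof.
move=> idL; elim/big_rec: _ => [|i M _ idM]; last exact: left_ideal_add.
by rewrite /left_ideal prodv0.
Qed.

(** Take a maximal set of the given simple ideals whose sum C meets L
    trivially. A simple ideal outside L + C would meet it trivially and could be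
    added to C. *)
Lemma semisimple_complement L : semisimple A -> left_ideal L ->
  exists C, [/\ left_ideal C, (L :&: C = 0)%VS & (L + C = fullv)%VS].
Proof.
move=> [r [S [simpleS _ sumS]]] idL.
have idS i : left_ideal (S i) by have [] := simpleS i.
pose P (T : {set 'I_r}) := (L :&: \sum_(i in T) S i == 0)%VS.
have P0 : P set0 by rewrite /P big_set0 capv0.
have [T maxT _] := maxset_exists P0; have [/eqP PT maxPT] := maxsetP maxT.
set C := (\sum_(i in T) S i)%VS in PT.
have idC : left_ideal C by exact: left_ideal_sum.
exists C; split=> //; apply/eqP; rewrite eqEsubv subvf -sumS.
apply/subv_sumP => i _; have [Ti | nTi] := boolP (i \in T).
  by apply: subv_trans (addvSr _ _); exact: (sumv_sup i).
have [_ _ simpleSi] := simpleS i.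
have [||cap0|<-] := simpleSi (S i :&: (L + C))%VS; last exact: capvSr.
- by apply: left_ideal_cap (left_ideal_add _ _).
- exact: capvSl.
have PTi : P (i |: T).
  rewrite /P big_setU1 //= -subv0; apply/subvP => x.
  rewrite memv_cap => /andP[Lx /memv_addP[s Ss [c Cc def_x]]].
  have : s \in (S i :&: (L + C))%VS.
    rewrite memv_cap Ss; apply/memv_addP; exists x => //.
    by exists (- c); rewrite ?memvN // def_x addrK.
  rewrite cap0 memv0 => /eqP s0.
  by rewrite -PT memv_cap Lx def_x s0 add0r.
by case/negP: nTi; rewrite -(maxPT _ PTi (subsetUr _ _)) setU11.
Qed.

(** The component in L of 1 along a complement of L. *)
Lemma semisimple_idempotent L : semisimple A -> left_ideal L -> L != 0%VS ->
  exists e, [/\ e \in L, e != 0 & e * e = e].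
Proof.
move=> ssA idL L0; have [C [idC capLC sumLC]] := semisimple_complement ssA idL.
have /memv_addP[e Le [c Cc def1]] : 1 \in (L + C)%VS by rewrite sumLC memvf.
have cap0 x : x \in L -> x \in C -> x = 0.
  by move=> Lx Cx; apply/eqP; rewrite -memv0 -capLC memv_cap Lx.
have {}idL := left_idealP _ idL; have {}idC := left_idealP _ idC.
exists e; split=> //.
  apply: contraNneq L0 => e0; rewrite -subv0; apply/subvP => x Lx.
  by rewrite memv0 (cap0 x) // -(mulr1 x) def1 e0 add0r idC.
have e_split : e = e * e + e * c by rewrite -mulrDr -def1 mulr1.
have ec0 : e * c = 0.
  apply: cap0; last exact: idC.
  have -> : e * c = e - e * e by rewrite [X in X - _]e_split addrC addKr.
  by rewrite memvB ?idL.
by rewrite [RHS]e_split ec0 addr0.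
Qed.

End SemisimpleIdeals.

(** * The action on charts *)

Lemma posnat_ker_cardA (K : fieldType) (ell : posnat_hom K)
    (F G H L : finGroupType) (U : {group F * G}) (V : {group G * H})
    (W : {group H * L}) :
  ell (ker_card U V) * ell (ker_card (star U V) W)
  = ell (ker_card U (star V W)) * ell (ker_card V W).
Proof. by rewrite -!posnat_homM ?ker_card_gt0 // ker_cardA. Qed.

Section Action.

Variables (K : fieldType) (m : nat) (G : 'I_m.+1 -> finGroupType).
Variable ell : posnat_hom K.
Local Notation I := 'I_m.+1.
Local Notation L := (Lambda G ell).
Implicit Types x y : L.

(** The coefficient of W in the formal product of x by V. No restriction to
    charts is made, so that the case E = G k gives the product of Lambda
    itself. *)
Definition act_coef (E : finGroupType) x (i k : I) (W : {group G i * E})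
    (V : {group G k * E}) : K :=
  \sum_(U : {group G i * G k} | star U V == W) x (symb U) * ell (ker_card U V).

Lemma act_coefM (E : finGroupType) x y i k (W : {group G i * E})
    (V : {group G k * E}) :
  act_coef (x * y) W V =
  \sum_j \sum_(Q : {group G j * E}) act_coef x W Q * act_coef y Q V.
Proof.
transitivity (\sum_j \sum_(U : {group G i * G j})
    \sum_(U' : {group G j * G k} | star U (star U' V) == W)
      x (symb U) * y (symb U') *
        (ell (ker_card U (star U' V)) * ell (ker_card U' V))).
  rewrite /act_coef.
  under eq_bigr => T _ do rewrite [(x * y) _]Lambda_mulE mulr_suml.
  rewrite exchange_big; apply: eq_bigr => j _ /=.
  under eq_bigr => T _ do rewrite mulr_suml.
  rewrite exchange_big; apply: eq_bigr => U _ /=.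
  under eq_bigr => T _ do rewrite mulr_suml.
  rewrite (exchange_big_dep (fun U' => star U (star U' V) == W)) /=; last first.
    by move=> T U' /eqP TW /eqP UT; rewrite starA UT TW.
  apply: eq_bigr => U' UW; rewrite (big_pred1 (star U U')) => [|T].
    rewrite /sigma -!mulrA; congr (_ * (_ * _)).
    exact: posnat_ker_cardA.
  rewrite /= [RHS]eq_sym; case: (star U U' =P T) => [<-|]; last by rewrite andbF.
  by rewrite -starA UW.
apply: eq_bigr => j _; rewrite [RHS](_ : _ =
  \sum_(Q : {group G j * E}) \sum_(U : {group G i * G j} | star U Q == W)
  \sum_(U' : {group G j * G k} | star U' V == Q)
      x (symb U) * y (symb U') * (ell (ker_card U Q) * ell (ker_card U' V)));
  last first.
  apply: eq_bigr => Q _; rewrite /act_coef mulr_suml; apply: eq_bigr => U _.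
  by rewrite mulr_sumr; apply: eq_bigr => U' _; rewrite mulrACA.
rewrite [RHS](exchange_big_dep xpredT) //=; apply: eq_bigr => U _.
rewrite [RHS](exchange_big_dep (fun U' => star U (star U' V) == W)) /=;
  last first.
  by move=> Q U' /eqP <- /eqP ->.
apply: eq_bigr => U' UW; rewrite (big_pred1 (star U' V)) // => Q.
by rewrite /= [RHS]eq_sym; case: (star U' V =P Q) => [<-|]; rewrite ?UW ?andbF.
Qed.

(** Both the condition on U and the factor ell depend only on the left section
    of V: acting on an arbitrary subgroup reduces to acting on a chart. *)
Lemma act_coef_left_section (E H : finGroupType) x i k (U0 : {group G i * G k})
    (V : {group G k * E}) (V' : {group G k * H}) :
  left_section V = left_section V' ->
  act_coef x (star U0 V) V = act_coef x (star U0 V') V'.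
Proof.
move=> VV'; apply: eq_big => [U | U _].
  by apply/eqP/eqP => /eq_star_left_section; apply.
by rewrite (ker_card_left_section _ VV').
Qed.

Lemma act_coef_nonchart (E : finGroupType) x i k (W : {group G i * E})
    (V : {group G k * E}) : chart W -> ~~ chart V -> act_coef x W V = 0.
Proof.
move=> cW ncV; apply: big_pred0 => U; apply: contraNF ncV => /eqP UV.
by apply: (chart_cofactor (U := U)); rewrite UV.
Qed.

Lemma act_coef_aut (E : finGroupType) x i k (W : {group G i * E})
    (V : {group G k * E}) (a : Aut_type E) :
  act_coef x (star W (aut_graph a)) (star V (aut_graph a)) = act_coef x W V.
Proof.
apply: eq_big => [U | U _]; last first.
  by rewrite (ker_card_left_section _ (left_section_aut V a)).
apply/eqP/eqP => [|<-]; last by rewrite starA.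
move/(congr1 (fun X => star X (aut_graph a^-1))).
by rewrite -!starA aut_graphM mulgV aut_graph1 !star1r.
Qed.

Lemma Lambda_mul_act_coef x y i k (W : {group G i * G k}) :
  (x * y) (symb W) =
  \sum_j \sum_(V : {group G j * G k}) act_coef x W V * y (symb V).
Proof.
rewrite [LHS]Lambda_mulE; apply: eq_bigr => j _.
rewrite (exchange_big_dep xpredT) //=; apply: eq_bigr => V _.
rewrite mulr_suml; apply: eq_bigr => U _.
by rewrite mulrAC.
Qed.

(** Keeping the index i in the value allows sections of subgroups of different
    groups to be compared by a plain equality. *)
Definition section_triple (i : I) (H : finGroupType) (V : {group G i * H})
    : triple G :=
  Tagged (fun i => ({group G i} * {group G i})%type) (left_section V).

Section Charts.

Variable E : finGroupType.
Local Notation n := #|factor_triples G E|.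

(** A chart of the section t; the default is met only when no chart exists,
    that is outside [factor_triples G E]. *)
Definition chart_of (t : triple G) : {group G (tag t) * E} :=
  odflt 1%G [pick V | chart V && (left_section V == tagged t)].

Lemma chart_ofP t : t \in factor_triples G E ->
  chart (chart_of t) /\ left_section (chart_of t) = tagged t.
Proof.
rewrite /chart_of => t_fac; case: pickP => [V /andP[cV /eqP] //|noV].
move: t_fac; rewrite inE; case def_t: (tagged t) => [B Y] /andP[nYB isoE].
have [V cV sV] := exists_chart nYB isoE.
by have := noV V; rewrite cV sV def_t eqxx.
Qed.

Definition nth_chart (s : 'I_n) := chart_of (enum_val s).

Lemma nth_chart_chart s : chart (nth_chart s).
Proof. by have [] := chart_ofP (enum_valP s). Qed.

Lemma nth_chart_section s : section_triple (nth_chart s) = enum_val s.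
Proof.
have [_] := chart_ofP (enum_valP s); rewrite /section_triple /nth_chart => ->.
by case: (enum_val s).
Qed.

Lemma section_triple_factor i (V : {group G i * E}) :
  chart V -> section_triple V \in factor_triples G E.
Proof. by move=> cV; rewrite inE /= left_kernel_normal chart_section_isog. Qed.

Definition tagged_chart (p : 'I_n * Aut_type E) : {i : I & {group G i * E}} :=
  Tagged (fun i => {group G i * E})
    (star (nth_chart p.1) (aut_graph p.2)).

Lemma tagged_chart_inj : injective tagged_chart.
Proof.
move=> [s a] [s' a'] eq_c.
have eq_s : s = s'.
  apply: enum_val_inj; rewrite -(nth_chart_section s) -(nth_chart_section s').
  have := congr1 (fun c => section_triple (tagged c)) eq_c.
  by rewrite /section_triple /= !left_section_aut.
case: _ / eq_s eq_c => /eqP; rewrite /tagged_chart /= eq_Tagged => /eqP eq_c.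
by rewrite (chart_aut_inj (nth_chart_chart s) eq_c).
Qed.

(** The chart chosen for the section of V differs from V by an
    automorphism. *)
Lemma tagged_chart_cover i (V : {group G i * E}) : chart V ->
  exists p, tagged_chart p = Tagged (fun i => {group G i * E}) V.
Proof.
move=> cV; have tV := section_triple_factor cV.
have [cT sT] := chart_ofP tV.
have [a ->] := chart_torsor cT cV sT.
exists (enum_rank_in tV (section_triple V), a).
by rewrite /tagged_chart /nth_chart /= enum_rankK_in.
Qed.

Lemma sum_charts (R : nmodType) (F : forall i, {group G i * E} -> R) :
  \sum_i \sum_(V : {group G i * E} | chart V) F i V =
  \sum_s \sum_a F _ (star (nth_chart s) (aut_graph a)).
Proof.
rewrite pair_bigA /= sig_big_dep /=.
pose F' (c : {i : I & {group G i * E}}) := F (tag c) (tagged c).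
rewrite [RHS](_ : _ = \sum_(p in setT) F' (tagged_chart p)); last first.
  by apply: eq_bigl => p; rewrite inE.
rewrite -(big_imset F' (in2W tagged_chart_inj)) /=; apply: eq_bigl => -[i V] /=.
apply/idP/imsetP => [/tagged_chart_cover[p pV]|[p _ pV]].
  by exists p; rewrite ?inE.
have : chart (tagged (tagged_chart p)) by rewrite chart_aut ?nth_chart_chart.
by rewrite -pV.
Qed.

(** Matrix of the action of x on the span of the charts, in the basis
    [nth_chart] over the group algebra: the coefficient at a of the entry (s, t)
    is that of the chart s twisted by a in x applied to the chart t. *)
Definition chart_rep x : 'M[group_alg K (Aut_type E)]_n :=
  \matrix_(s, t)
    [ffun a => act_coef x (star (nth_chart s) (aut_graph a)) (nth_chart t)].

Lemma chart_repE x s t a : (chart_rep x s t : group_alg K (Aut_type E)) a =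
  act_coef x (star (nth_chart s) (aut_graph a)) (nth_chart t).
Proof. by rewrite mxE ffunE. Qed.

Lemma chart_repM x y : chart_rep (x * y) = chart_rep x *m chart_rep y.
Proof.
apply/matrixP => s t; apply/ffunP => a; rewrite chart_repE act_coefM.
rewrite [in RHS]mxE sum_ffunE.
transitivity (\sum_i \sum_(Q : {group G i * E} | chart Q)
    act_coef x (star (nth_chart s) (aut_graph a)) Q *
      act_coef y Q (nth_chart t)).
  apply: eq_bigr => i _; rewrite [RHS]big_mkcond; apply: eq_bigr => Q _.
  case: ifPn => // ncQ.
  by rewrite act_coef_nonchart ?mul0r // chart_aut ?nth_chart_chart.
rewrite sum_charts; apply: eq_bigr => u _.
(* By equivariance, the term at b is that of the convolution at a * b^-1. *)
rewrite [RHS]ffunE [RHS](reindex_inj (inj_comp (mulgI a) invg_inj)) /=.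
apply: eq_bigr => b _; rewrite !chart_repE; congr (_ * _).
  rewrite -[RHS](act_coef_aut _ _ _ b) -(starA (nth_chart s)) aut_graphM.
  by rewrite mulgKV.
by rewrite invMg invgK mulgKV.
Qed.

Lemma chart_rep_linear c x y : chart_rep (c *: x + y) =
  map_mx (fun u : group_alg K (Aut_type E) => c *: u) (chart_rep x)
  + chart_rep y.
Proof.
apply/matrixP => s t; apply/ffunP => a; rewrite chart_repE.
rewrite [in RHS]mxE [in RHS]mxE !ffunE !chart_repE.
rewrite /act_coef scaler_sumr -big_split; apply: eq_bigr => U _ /=.
by rewrite ffunE Lambda_scaleE mulrDl -mulrA.
Qed.

(** By equivariance, an entry between arbitrary charts is a coefficient of the
    matrix. *)
Lemma chart_rep_act_coef x i k (W : {group G i * E}) (V : {group G k * E}) :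
  chart_rep x = 0 -> chart W -> chart V -> act_coef x W V = 0.
Proof.
move=> x0 cW cV.
have [[s a] defW] := tagged_chart_cover cW.
have [[t b] defV] := tagged_chart_cover cV.
pose f (c d : {i : I & {group G i * E}}) := act_coef x (tagged c) (tagged d).
rewrite -[LHS]/(f (Tagged (fun i => {group G i * E}) W)
                  (Tagged (fun i => {group G i * E}) V)).
rewrite -defW -defV /f /tagged_chart /=.
rewrite -(mulgKV b a) -aut_graphM starA act_coef_aut -chart_repE x0.
by rewrite mxE ffunE.
Qed.

End Charts.

(** * The joint kernel of the representations *)

Section Kernel.

Variables (J : finType) (E : J -> finGroupType).
Hypothesis E_reps : factor_group_reps G E.

(** The section of V is a factor group of G k, hence isomorphic to one of the
    representatives. *)
Lemma exists_model_chart k (H : finGroupType) (V : {group G k * H}) :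
  exists j (T : {group G k * E j}), chart T /\ left_section T = left_section V.
Proof.
have [_ E_all _] := E_reps.
pose Q := (left_domain V / left_kernel_group V)%G.
have [|j isoE] := E_all (subg_of Q) k.
  exists (left_domain V), (left_kernel_group V).
  by split; [exact: left_kernel_normal | rewrite isog_sym; exact: isog_subg].
have isoQ := isog_trans (isog_subg Q) isoE.
have [T cT sT] := exists_chart (left_kernel_normal V) isoQ.
by exists j, T.
Qed.

(** If star U V = W for some U, the ranks force the right sections of V and W to
    agree, and then a chart T of the section of V is sent by U to a chart; the
    coefficient is an entry of the representation. *)
Lemma act_coef_eq0 x i k (H : finGroupType) (W : {group G i * H})
    (V : {group G k * H}) :
  (forall j, chart_rep (E j) x = 0) -> (right_rank V <= right_rank W)%N ->
  act_coef x W V = 0.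
Proof.
move=> x0 leVW.
case: (pickP (fun U : {group G i * G k} => star U V == W)) => [U /eqP UV|noU].
  have [j [T [cT sT]]] := exists_model_chart V.
  rewrite -UV -(act_coef_left_section _ _ sT).
  apply: chart_rep_act_coef => //; apply: chart_star_right_section sT _ => //.
  by apply: right_rank_star; rewrite UV.
exact: big_pred0.
Qed.

Definition symbol_rank (u : symbol G) : nat := right_rank (tagged (tagged u)).

(** At a symbol of largest rank in its support, the coefficient of x = x * x
    would come from a symbol of larger rank. *)
Lemma kernel_idempotent x :
  (forall j, chart_rep (E j) x = 0) -> x * x = x -> x = 0.
Proof.
move=> x0 xx; apply/eqP; apply: contraTT isT => nz_x.
have [u0 xu0] : exists u, x u != 0.
  apply/existsP; apply: contraNT nz_x => /existsPn x_u0.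
  by apply/eqP/ffunP => u; rewrite ffunE; apply/eqP; rewrite -[_ == _]negbK x_u0.
have [u xu max_u] := @arg_maxnP _ u0 (fun u => x u != 0) symbol_rank xu0.
case/negP: xu; move: max_u; elim/symb_ind: u => i k W max_W.
rewrite -{1}xx Lambda_mul_act_coef; apply/eqP.
apply: big1 => j _; apply: big1 => V _.
have [-> | xV] := eqVneq (x (symb V)) 0; first by rewrite mulr0.
by rewrite act_coef_eq0 ?mul0r //; exact: (max_W (symb V) xV).
Qed.

End Kernel.

End Action.

(** * The isomorphism with the sum of matrix algebras *)

Section DirectSum.

Variables (K : fieldType) (m : nat) (G : 'I_m.+1 -> finGroupType).
Variables (ell : posnat_hom K) (J : finType) (E : J -> finGroupType).
Hypothesis E_reps : factor_group_reps G E.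
Local Notation L := (Lambda G ell).
Local Notation n j := #|factor_triples G (E j)|.
Local Notation M :=
  (mx_sum (fun j : J => group_alg K (Aut_type (E j)) : algType K)
          (fun j : J => n j)).

Definition mxunit_index : Type :=
  {j : J & ('I_(n j) * 'I_(n j) * Aut_type (E j))%type}.
HB.instance Definition _ := Finite.on mxunit_index.

(** V_s a V_t^-1: a subgroup with left section s, right section t, and the
    isomorphism between them given by a. *)
Definition mxunit_symbol (p : mxunit_index) : symbol G :=
  let: (s, t, a) := tagged p in
  symb (star (star (nth_chart s) (aut_graph a)) (converse (nth_chart t))).

(** The sections of the subgroup give s and t, and so the isomorphism type of
    E j, which determines j; then a is recovered by cancelling the charts. *)
Lemma mxunit_symbol_inj : injective mxunit_symbol.
Proof.
have [_ _ E_inj] := E_reps.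
move=> [j [[s t] a]] [j' [[s' t'] a']]; rewrite /mxunit_symbol /= => eq_u.
have eq_s : enum_val s = enum_val s' :> triple G.
  have := congr1 (fun u : symbol G => section_triple (tagged (tagged u))) eq_u.
  rewrite /section_triple /= !left_section_star_converse ?nth_chart_chart //.
  rewrite !left_section_aut => eq_t.
  by rewrite -(nth_chart_section s) -(nth_chart_section s').
have eq_t : enum_val t = enum_val t' :> triple G.
  pose right_triple (u : symbol G) :=
    section_triple (converse (tagged (tagged u))).
  have := congr1 right_triple eq_u; rewrite /right_triple.
  rewrite /section_triple /= !right_section_star_converse ?chart_aut
    ?nth_chart_chart // => eq_t.
  by rewrite -(nth_chart_section t) -(nth_chart_section t').
have eq_j : j = j'.
  apply: E_inj; have := enum_valP s'; rewrite -eq_s; have := enum_valP s.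
  rewrite !inE; case: (tagged _) => B Y /andP[_ iso1] /andP[_ iso2].
  by apply: isog_trans iso2; rewrite isog_sym.
case: _ / eq_j s' t' a' eq_s eq_t eq_u => s' t' a'.
move=> /enum_val_inj <- /enum_val_inj <- /symb_inj eq_u; suff -> : a = a' by [].
apply: (chart_aut_inj (nth_chart_chart s)).
have := congr1 (fun X => star X (nth_chart t)) eq_u.
by rewrite -!starA (eqP (nth_chart_chart t)) !star1r.
Qed.

Definition entry (y : M) (p : mxunit_index) : K :=
  (y (tag p) (tagged p).1.1 (tagged p).1.2 : group_alg K (Aut_type (E (tag p))))
    (tagged p).2.

Definition mxunit_embed (y : M) : L :=
  [ffun u => \sum_(p : mxunit_index) entry y p * (u == mxunit_symbol p)%:R].

Lemma mxunit_embedE y p : mxunit_embed y (mxunit_symbol p) = entry y p.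
Proof.
rewrite ffunE (bigD1 p) //= eqxx mulr1 big1 ?addr0 // => q qp.
by rewrite (inj_eq mxunit_symbol_inj) eq_sym (negPf qp) mulr0.
Qed.

Lemma mxunit_embed_inj : injective mxunit_embed.
Proof.
move=> y z yz; apply/ffunP => j; apply/matrixP => s t; apply/ffunP => a.
pose p : mxunit_index :=
  Tagged (fun j => ('I_(n j) * 'I_(n j) * Aut_type (E j))%type) (s, t, a).
by have := mxunit_embedE y p; rewrite yz mxunit_embedE.
Qed.

Lemma mxunit_embed_linear c y z :
  mxunit_embed (c *: y + z) = c *: mxunit_embed y + mxunit_embed z.
Proof.
apply/ffunP => u; rewrite !ffunE scaler_sumr -big_split; apply: eq_bigr => p _ /=.
by rewrite /entry !ffunE !mxE !ffunE mulrDl -mulrA.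
Qed.

Definition chart_reps (x : L) : M := [ffun j => chart_rep (E j) x].

Lemma chart_repsM x y : chart_reps (x * y) = chart_reps x * chart_reps y.
Proof. by apply/ffunP => j; rewrite !ffunE chart_repM. Qed.

Lemma chart_reps_linear c x y :
  chart_reps (c *: x + y) = c *: chart_reps x + chart_reps y.
Proof. by apply/ffunP => j; rewrite !ffunE chart_rep_linear. Qed.

HB.instance Definition _ := GRing.isLinear.Build K L M *:%R
  chart_reps chart_reps_linear.

HB.instance Definition _ := GRing.isLinear.Build K M L *:%R
  mxunit_embed mxunit_embed_linear.

(** The embedding back in Lambda realizes the kernel as a subspace of Lambda;
    it is a left ideal without nonzero idempotents. *)
Lemma chart_reps_inj : semisimple L -> injective chart_reps.
Proof.
move=> ssL.
pose N := lker (linfun (mxunit_embed \o chart_reps)).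
have NP x : (x \in N) = (chart_reps x == 0).
  by rewrite memv_ker lfunE /= -[X in _ == X](linear0 mxunit_embed)
    (inj_eq mxunit_embed_inj).
apply: raddf_inj => x x0; apply/eqP; rewrite -memv0.
suff <- : N = 0%VS by rewrite NP x0.
apply/eqP; apply: contraTT isT => N0.
have idN : left_ideal N.
  by apply/left_idealP => a y; rewrite !NP chart_repsM => /eqP ->; rewrite mulr0.
have [e [+ e0 ee]] := semisimple_idempotent ssL idN N0; rewrite NP => /eqP repe0.
case/negP: e0; apply/eqP; apply: (kernel_idempotent E_reps) => // j.
by have /ffunP/(_ j) := repe0; rewrite !ffunE.
Qed.

(** The composite with the embedding is an injective endomorphism of a
    finite-dimensional space. *)
Lemma chart_reps_bij : semisimple L -> bijective chart_reps.
Proof.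
move=> /chart_reps_inj injf; pose h := linfun (mxunit_embed \o chart_reps).
have hE x : h x = mxunit_embed (chart_reps x) by rewrite lfunE.
have h_inj : lker h == 0%VS.
  by apply/lker0P => x y; rewrite !hE => /mxunit_embed_inj/injf.
exists (h^-1%VF \o mxunit_embed) => x /=; first by rewrite -hE lker0_lfunK.
by apply: mxunit_embed_inj; rewrite -hE lker0_lfunVK.
Qed.

End DirectSum.

Theorem theorem1p2 (K : fieldType) (charK0 : [pchar K] =i pred0)
    (m : nat) (G : 'I_m.+1 -> finGroupType) (ell : posnat_hom K)
    (Lambda_semisimple : semisimple (Lambda G ell))
    (J : finType) (E : J -> finGroupType) (E_reps : factor_group_reps G E) :
  exists f : {rmorphism Lambda G ell ->
      mx_sum (fun j : J => group_alg K (Aut_type (E j)) : algType K)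
             (fun j : J => #|factor_triples G (E j)|)},
    scalable f /\ bijective f.
Proof.
pose f := @chart_reps K m G ell J E.
have f_bij : bijective f := chart_reps_bij E_reps Lambda_semisimple.
(* The preimage of 1 shows that f 1, an identity for the image of f, is 1. *)
have f1 : f 1 = 1.
  have [g _ gK] := f_bij.
  by rewrite -[LHS]mulr1 -[in LHS](gK 1) -chart_repsM mul1r; exact: gK.
have fM : monoid_morphism f by split=> //; exact: chart_repsM.
pose fm := GRing.isMonoidMorphism.Build _ _ f fM.
pose F : {rmorphism _ -> _} := HB.pack f fm.
by exists F; split=> // c x; exact: (linearZ_LR (@chart_reps K m G ell J E)).
Qed.
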